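(* There is a constant $\theta_{\mathcal{S}^\star}>0$, depending only on the problem through its primal-dual solution set $\mathcal{S}^\star$ (as described by its defining linear system), such that the following holds for every $\rho>0$ and every $Y_0\in\mathbb{R}^{m\times n}$. Let $X_k,Y_k$ be generated, for $k=0,1,2,\dots$, by $$X_{k+1}=[Y_k-\rho C]_+,\qquad Z_{k+1}=\mathsf{P}_{\mathcal{X}}(2X_{k+1}-Y_k),\qquad Y_{k+1}=Y_k+Z_{k+1}-X_{k+1}.$$ Let $\mathcal{G}^\star$ be the set of fixed points of $T$ and let $\mathcal{X}^\star$ be the set of solutions of the optimal transport problem. Then $\{Y_k\}$ is bounded and, for $M$ such that $\|Y_k\|\le M$ for all $k$, $$\mathrm{dist}(Y_k,\mathcal{G}^\star)\le \mathrm{dist}(Y_0,\mathcal{G}^\star)\, r^k \quad (k\ge 0),$$ $$\mathrm{dist}(X_k,\mathcal{X}^\star)\le \mathrm{dist}(Y_0,\mathcal{G}^\star)\, r^{k-1}\quad (k\ge 1),$$ where $r=c/\sqrt{c^2+1}<1$, $c=\gamma\big(1+\rho(\|e\|+\|f\|)\big)\ge 1$, and $\gamma=\theta_{\mathcal{S}^\star}\big(1+\rho^{-1}(M+1)\big)$.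
   Context: Let $m,n\ge 1$, $C\in\mathbb{R}_+^{m\times n}$, and let $p\in\mathbb{R}_+^m$, $q\in\mathbb{R}_+^n$ be probability vectors (entries summing to $1$). Let $e=\mathbf{1}_n$, $f=\mathbf{1}_m$ be the all-ones vectors. The optimal transport problem is to minimize $\langle C,X\rangle$ over $X\in\mathbb{R}^{m\times n}$ subject to $X\ge 0$ entrywise, $Xe=p$, $X^\top f=q$; its dual is to maximize $p^\top\mu+q^\top\nu$ over $\mu\in\mathbb{R}^m,\nu\in\mathbb{R}^n$ subject to $\mu e^\top+f\nu^\top\le C$ entrywise. $\langle X,Y\rangle=\mathrm{tr}(X^\top Y)$; $\|\cdot\|$ is the Frobenius norm for matrices and the Euclidean norm for vectors; $\mathrm{dist}(x,S)=\min_{z\in S}\|z-x\|$. $\mathcal{X}=\{X\in\mathbb{R}^{m\times n}: Xe=p,\ X^\top f=q\}$, $\mathsf{P}_{\mathcal{X}}$ is the Euclidean projection onto $\mathcal{X}$, and $[X]_+=\max(X,0)$ entrywise. The map $T:\mathbb{R}^{m\times n}\to\mathbb{R}^{m\times n}$ is $T(Y)=Y+\mathsf{P}_{\mathcal{X}}\big(2[Y-\rho C]_+-Y\big)-[Y-\rho C]_+$ (so $Y_{k+1}=T(Y_k)$). The primal-dual solution set is the polyhedron $\mathcal{S}^\star$ of all $(X,Z,\mu,\nu)\in\mathbb{R}^{m\times n}\times\mathbb{R}^{m\times n}\times\mathbb{R}^m\times\mathbb{R}^n$ with $Ze=p$, $Z^\top f=q$, $X\ge 0$, $Z=X$, $\mu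 e^\top+f\nu^\top\le C$, $\langle C,X\rangle-p^\top\mu-q^\top\nu=0$. In particular the constant $\theta_{\mathcal{S}^\star}$ does not depend on $\rho$, $Y_0$, $M$ or $k$. *)

(* Defs.v *)
From HB Require Import structures.
From mathcomp Require Import all_boot all_order all_algebra.
From mathcomp Require Import boolp classical_sets reals.

Set Implicit Arguments.
Unset Strict Implicit.
Unset Printing Implicit Defensive.

Import Order.TTheory GRing.Theory Num.Theory.
Local Open Scope classical_set_scope.
Local Open Scope ring_scope.

Definition mxdot (R : realType) (m n : nat) (X Y : 'M[R]_(m, n)) : R :=
  \tr (X^T *m Y).

(* Frobenius norm, and Euclidean norm on column vectors; the norm `|_| that
   MathComp-Analysis puts on matrices is the sup norm. *)
Definition frob (R : realType) (m n : nat) (X : 'M[R]_(m, n)) : R :=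
  Num.sqrt (mxdot X X).

(* A nearest point of S to Y (0 if there is none); it is unique when S is
   nonempty, closed and convex. *)
Definition proj (R : realType) (m n : nat) (S : set 'M[R]_(m, n))
    (Y : 'M[R]_(m, n)) : 'M[R]_(m, n) :=
  xget 0 [set Z | S Z /\ forall W, S W -> frob (Z - Y) <= frob (W - Y)].

(* min_{Z in S} ||Z - Y||, as the value at a minimizer; the value is meaningful
   when the minimum is attained, e.g. when S is nonempty and closed. *)
Definition dist (R : realType) (m n : nat) (Y : 'M[R]_(m, n))
    (S : set 'M[R]_(m, n)) : R :=
  frob (proj S Y - Y).

Definition pospart (R : realType) (m n : nat) (X : 'M[R]_(m, n)) :
  'M[R]_(m, n) := map_mx (fun x => Num.max x 0) X.

Definition ones (R : realType) (n : nat) : 'cV[R]_n := const_mx 1.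

Definition is_prob (R : realType) (n : nat) (p : 'cV[R]_n) : Prop :=
  (forall i, 0 <= p i 0) /\ \sum_i p i 0 = 1.

Definition marginals (R : realType) (m n : nat) (p : 'cV[R]_m) (q : 'cV[R]_n) :
    set 'M[R]_(m, n) :=
  [set X | X *m ones R n = p /\ X^T *m ones R m = q].

Definition transport_plan (R : realType) (m n : nat) (p : 'cV[R]_m)
    (q : 'cV[R]_n) : set 'M[R]_(m, n) :=
  [set X | marginals p q X /\ forall i j, 0 <= X i j].

Definition ot_solutions (R : realType) (m n : nat) (C : 'M[R]_(m, n))
    (p : 'cV[R]_m) (q : 'cV[R]_n) : set 'M[R]_(m, n) :=
  [set X | transport_plan p q X /\
           forall X', transport_plan p q X' -> mxdot C X <= mxdot C X'].

Definition dr_map (R : realType) (m n : nat) (C : 'M[R]_(m, n))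
    (p : 'cV[R]_m) (q : 'cV[R]_n) (rho : R) (Y : 'M[R]_(m, n)) :
    'M[R]_(m, n) :=
  Y + proj (marginals p q) (2 *: pospart (Y - rho *: C) - Y)
    - pospart (Y - rho *: C).

Definition dr_fixed (R : realType) (m n : nat) (C : 'M[R]_(m, n))
    (p : 'cV[R]_m) (q : 'cV[R]_n) (rho : R) : set 'M[R]_(m, n) :=
  [set Y | dr_map C p q rho Y = Y].

(* A description of a polyhedron: finitely many equations l x = b and
   inequalities l x <= b. Distinct descriptions may have the same solutions. *)
Record linear_system (R : realType) (V : lmodType R) := LinearSystem {
  equations : seq ({scalar V} * R);
  inequalities : seq ({scalar V} * R) }.

Definition solutions (R : realType) (V : lmodType R) (L : linear_system V) :
    set V :=
  [set x | all (fun c : {scalar V} * R => c.1 x == c.2) (equations L) /\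
           all (fun c : {scalar V} * R => c.1 x <= c.2) (inequalities L)].

(* Tuples (X, Z, mu, nu). *)
Definition pd_space (R : realType) (m n : nat) : lmodType R :=
  ('M[R]_(m, n) * 'M[R]_(m, n) * 'cV[R]_m * 'cV[R]_n)%type.

Section PrimalDual.
Variables (R : realType) (m n : nat).
Local Notation V := (pd_space R m n).

Definition pd_X (w : V) : 'M[R]_(m, n) := w.1.1.1.
Definition pd_Z (w : V) : 'M[R]_(m, n) := w.1.1.2.
Definition pd_mu (w : V) : 'cV[R]_m := w.1.2.
Definition pd_nu (w : V) : 'cV[R]_n := w.2.

Definition row_sum (i : 'I_m) (w : V) : R := (pd_Z w *m ones R n) i 0.
Definition col_sum (j : 'I_n) (w : V) : R := ((pd_Z w)^T *m ones R m) j 0.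
Definition consensus (i : 'I_m) (j : 'I_n) (w : V) : R :=
  pd_Z w i j - pd_X w i j.
Definition opp_entry (i : 'I_m) (j : 'I_n) (w : V) : R := - pd_X w i j.
Definition potential (i : 'I_m) (j : 'I_n) (w : V) : R :=
  (pd_mu w *m (ones R n)^T + ones R m *m (pd_nu w)^T) i j.
Definition duality_gap (C : 'M[R]_(m, n)) (p : 'cV[R]_m) (q : 'cV[R]_n)
    (w : V) : R :=
  mxdot C (pd_X w) - mxdot p (pd_mu w) - mxdot q (pd_nu w).

Lemma row_sum_scalar i : scalar (row_sum i).
Proof. by move=> a u v; rewrite /row_sum /pd_Z /= mulmxDl -scalemxAl !mxE. Qed.

Lemma col_sum_scalar j : scalar (col_sum j).
Proof.
by move=> a u v; rewrite /col_sum /pd_Z /= linearP mulmxDl -scalemxAl !mxE.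
Qed.

Lemma consensus_scalar i j : scalar (consensus i j).
Proof.
by move=> a u v; rewrite /consensus /pd_Z /pd_X /= !mxE mulrBr opprD addrACA.
Qed.

Lemma opp_entry_scalar i j : scalar (opp_entry i j).
Proof. by move=> a u v; rewrite /opp_entry /pd_X /= !mxE opprD mulrN. Qed.

Lemma potential_scalar i j : scalar (potential i j).
Proof.
move=> a u v; rewrite /potential /pd_mu /pd_nu /= linearP mulmxDl mulmxDr.
by rewrite -scalemxAl -scalemxAr !mxE mulrDr addrACA.
Qed.

Lemma mxdot_scalar k l (A : 'M[R]_(k, l)) : scalar (mxdot A).
Proof. by move=> a u v; rewrite /mxdot mulmxDr -scalemxAr mxtraceD mxtraceZ. Qed.

Lemma duality_gap_scalar C p q : scalar (duality_gap C p q).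
Proof.
move=> a u v; rewrite /duality_gap /pd_X /pd_mu /pd_nu /= !mxdot_scalar.
by rewrite !mulrBr !opprD [RHS]addrACA [X in _ = X + _]addrACA.
Qed.

HB.instance Definition _ i :=
  GRing.isLinear.Build R V R *%R (row_sum i) (@row_sum_scalar i).
HB.instance Definition _ j :=
  GRing.isLinear.Build R V R *%R (col_sum j) (@col_sum_scalar j).
HB.instance Definition _ i j :=
  GRing.isLinear.Build R V R *%R (consensus i j) (@consensus_scalar i j).
HB.instance Definition _ i j :=
  GRing.isLinear.Build R V R *%R (opp_entry i j) (@opp_entry_scalar i j).
HB.instance Definition _ i j :=
  GRing.isLinear.Build R V R *%R (potential i j) (@potential_scalar i j).
HB.instance Definition _ C p q :=
  GRing.isLinear.Build R V R *%R (duality_gap C p q)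
    (@duality_gap_scalar C p q).

Definition pd_system (C : 'M[R]_(m, n)) (p : 'cV[R]_m) (q : 'cV[R]_n) :
    linear_system V :=
  LinearSystem
    ([seq (row_sum i : {scalar V}, p i 0) | i <- enum 'I_m] ++
     [seq (col_sum j : {scalar V}, q j 0) | j <- enum 'I_n] ++
     [seq (consensus i j : {scalar V}, 0) | i <- enum 'I_m, j <- enum 'I_n] ++
     [:: (duality_gap C p q : {scalar V}, 0)])
    ([seq (opp_entry i j : {scalar V}, 0) | i <- enum 'I_m, j <- enum 'I_n] ++
     [seq (potential i j : {scalar V}, C i j)
        | i <- enum 'I_m, j <- enum 'I_n]).

Lemma pd_systemP (C : 'M[R]_(m, n)) (p : 'cV[R]_m) (q : 'cV[R]_n)
    (X Z : 'M[R]_(m, n)) (mu : 'cV[R]_m) (nu : 'cV[R]_n) :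
  solutions (pd_system C p q) (X, Z, mu, nu) <->
  [/\ Z *m ones R n = p /\ Z^T *m ones R m = q,
      forall i j, 0 <= X i j,
      Z = X,
      forall i j, (mu *m (ones R n)^T + ones R m *m nu^T) i j <= C i j &
      mxdot C X - (p^T *m mu) 0 0 - (q^T *m nu) 0 0 = 0].
Proof.
have dotE k (a b : 'cV[R]_k) : mxdot a b = (a^T *m b) 0 0.
  by rewrite /mxdot [a^T *m b]mx11_scalar mxtrace_scalar !mxE mulr1n.
have memF k (i : 'I_k) : i \in Finite.enum 'I_k.
  by rewrite -enumT mem_enum.
have memE k (i : 'I_k) : i \in enum 'I_k by rewrite mem_enum.
rewrite /solutions /= !all_cat /= andbT !all_map; split.
- case=> /and4P[/allP hr /allP hc /all_allpairsP he /eqP hg].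
  move=> /andP[/all_allpairsP hx /all_allpairsP hp].
  split.
  + split; apply/matrixP => i j; rewrite ord1.
      by apply/eqP; exact: (hr i (memF _ i)).
    by apply/eqP; exact: (hc i (memF _ i)).
  + by move=> i j; have := hx i j (memE _ _) (memE _ _);
      rewrite /= /opp_entry oppr_le0.
  + apply/matrixP => i j; apply/eqP; rewrite -subr_eq0.
    exact: (he i j (memE _ _) (memE _ _)).
  + by move=> i j; exact: (hp i j (memE _ _) (memE _ _)).
  + by rewrite -!dotE.
- case=> -[hr hc] hx he hp hg; split.
    apply/and4P; split.
    + by apply/allP => i _ /=; rewrite /row_sum /pd_Z /= hr.
    + by apply/allP => i _ /=; rewrite /col_sum /pd_Z /= hc.
    + apply/all_allpairsP => i j _ _ /=.
      by rewrite /consensus /pd_Z /pd_X /= he subrr.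
    + by rewrite /duality_gap /pd_X /pd_mu /pd_nu /= !dotE hg.
  apply/andP; split; apply/all_allpairsP => i j _ _ /=.
    by rewrite /opp_entry oppr_le0; exact: hx.
  exact: hp.
Qed.

End PrimalDual.

(* Main.v *)
Require Import Defs.
From HB Require Import structures.
From mathcomp Require Import all_boot all_order all_algebra.
From mathcomp Require Import boolp classical_sets reals.
From mathcomp Require Import topology normedtype derive.
From mathcomp Require Import ring lra.

Set Implicit Arguments.
Unset Strict Implicit.
Unset Printing Implicit Defensive.

Import Order.TTheory GRing.Theory Num.Theory.
Import numFieldNormedType.Exports.
Local Open Scope classical_set_scope.
Local Open Scope ring_scope.

(** Write T for the iteration map, G for the set of its fixed points, and
    D = T Y - Y for the step taken from Y. Linear convergence follows from two
    inequalities.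

    First, T is firmly nonexpansive, because entrywise positive part and
    projection onto an affine subspace both are. Applied at Y and at a fixed
    point W this gives |T Y - W|^2 + |D|^2 <= |Y - W|^2 (dr_fejer). With W the
    point of G nearest to Y, dist(T Y, G)^2 + |D|^2 <= dist(Y, G)^2.

    Second, a short step is only possible near G: dist(T Y, G) <= c |D|
    (dr_error_bound). Eliminating |D| between the two yields the factor
    c / sqrt(c^2 + 1) (contraction_factor). Since Y |-> [Y - rho C]_+ is
    nonexpansive and maps G into the set of optimal plans, the estimate for X_k
    is the one for Y_(k-1).

    The error bound comes from Hoffman's theorem. The projection onto the
    affine space of matrices with prescribed marginals moves a matrix by some
    outer sum mu e^T + f nu^T, so T Y = X + rho (mu e^T + f nu^T) with
    X = [Y - rho C]_+, and (X, X + D, mu, nu) violates every constraint of the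
    primal-dual system by at most |D| (1 + (|T Y| + 1) / rho); in particular the
    duality gap of this point is exactly - <D, T Y> / rho (dr_residual). By
    Hoffman there is a primal-dual solution at distance at most a constant times
    this residual, and every primal-dual solution (X, X, mu, nu) yields the fixed
    point X + rho (mu e^T + f nu^T) (pd_optimal_fixed). The constant depends on
    the linear system only, which is why it is uniform in rho, Y_0 and M.

    Hoffman's theorem is proved by Fourier-Motzkin elimination: eliminating one
    direction multiplies the residual by a bounded factor, and back substitution
    moves the eliminated coordinate by at most a constant times the residual. The
    same elimination gives Farkas' lemma, from which a dual solution
    complementary to an optimal plan is obtained (pd_optimal_exists), so that the
    primal-dual system is feasible. Nearest points and an optimal plan exist by
    compactness (lipschitz_min). *)

(** * Fourier-Motzkin elimination *)

Section FourierMotzkin.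
Variables (R : realFieldType) (V : lmodType R) (I : finType).
Variables (f : I -> V -> R) (b : I -> R) (d : V).

(** The new constraints are indexed by all pairs, so that no filtering of the
    index type is needed. A pair of constraints with slopes of opposite signs
    along d gives the nonnegative combination that cancels d; the diagonal keeps
    the constraints that do not see d; all other pairs give 0 <= 0. *)
Definition fm_weights (ij : I * I) : R * R :=
  let: (i, j) := ij in
  if (0 < f i d) && (f j d < 0) then (- f j d, f i d)
  else if f i d == 0 then (1, 0) else (0, 0).

Definition fm_fun (ij : I * I) (x : V) : R :=
  (fm_weights ij).1 * f ij.1 x + (fm_weights ij).2 * f ij.2 x.

Definition fm_bound (ij : I * I) : R :=
  (fm_weights ij).1 * b ij.1 + (fm_weights ij).2 * b ij.2.

Lemma fm_weights_ge0 ij : 0 <= (fm_weights ij).1 /\ 0 <= (fm_weights ij).2.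
Proof.
case: ij => i j /=; case: ifP => [/andP[fi fj]|_] /=; first by split; lra.
by case: ifP => _ /=; split.
Qed.

Lemma fm_fun_dir ij : fm_fun ij d = 0.
Proof.
case: ij => i j; rewrite /fm_fun /=; case: ifP => _ /=; first ring.
by case: ifP => [/eqP -> |_] /=; ring.
Qed.

Lemma fm_fun_scalar ij : (forall i, scalar (f i)) -> scalar (fm_fun ij).
Proof. by move=> lf a u v; rewrite /fm_fun !lf; ring. Qed.

(** Back substitution. Constraint i confines t to a half-line ending at q i, and
    the eliminated system says that every lower end is below every upper end.
    The t closest to 0 in that interval is an end point or 0 itself, so it is no
    larger than the violation at y divided by a slope. *)
Lemma fm_eliminate (y : V) (eps : R) :
  (forall i, scalar (f i)) -> 0 <= eps ->
  (forall ij, fm_fun ij y <= fm_bound ij) ->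
  (forall i, f i y <= b i + eps) ->
  exists2 t, `|t| <= (\sum_i `|f i d|^-1) * eps &
    forall i, f i (y + t *: d) <= b i.
Proof.
move=> lf eps0 hy hrel.
pose q i := (b i - f i y) / f i d.
(* A is the largest positive lower end, B the opposite of the smallest negative
   upper end. At most one of them is nonzero, hence A - B is the admissible
   value closest to 0. *)
pose A := \big[Num.max/0]_(i | f i d < 0) q i.
pose B := \big[Num.max/0]_(i | 0 < f i d) - q i.
have loA i : f i d < 0 -> q i <= A by move=> hi; exact: (le_bigmax_cond 0 q).
have hiB i : 0 < f i d -> - q i <= B.
  by move=> hi; exact: (le_bigmax_cond 0 (fun i => - q i)).
have A0 : 0 <= A by exact: bigmax_ge_id.
have B0 : 0 <= B by exact: bigmax_ge_id.
have lohi i j : 0 < f i d -> f j d < 0 -> q j <= q i.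
  move=> fi fj; have := hy (i, j); rewrite /fm_fun /fm_bound /= fi fj /= => h.
  by rewrite /q ler_pdivlMr // mulrAC ler_ndivrMr //; lra.
have AB : A = 0 \/ B = 0.
  have [B00|Bn0] := eqVneq B 0; first by right.
  left; apply/eqP; rewrite eq_le A0 andbT.
  have [j hj qj] : exists2 j, 0 < f j d & q j < 0.
    have : ~~ (B <= 0) by rewrite -ltNge lt_def Bn0.
    case: (boolP [exists j, (0 < f j d) && (q j < 0)]).
      by case/existsP => j /andP[]; exists j.
    rewrite negb_exists => /forallP h /negP[].
    apply: bigmax_le => // j hj; have := h j; rewrite hj /= -leNgt; lra.
  apply: bigmax_le => // i hi; have := lohi _ _ hj hi; lra.
have epsE i : (f i y - b i) / `|f i d| <= (\sum_i `|f i d|^-1) * eps.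
  apply: (@le_trans _ _ (`|f i d|^-1 * eps)).
    rewrite mulrC ler_wpM2l ?invr_ge0 //; have := hrel i; lra.
  rewrite ler_wpM2r // (bigD1 i) //= lerDl sumr_ge0 // => j _.
  by rewrite invr_ge0.
have S0 : 0 <= (\sum_i `|f i d|^-1) * eps.
  by rewrite mulr_ge0 // sumr_ge0 // => j _; rewrite invr_ge0.
have AS : A <= (\sum_i `|f i d|^-1) * eps.
  apply: bigmax_le => // i hi; apply: le_trans (epsE i).
  by rewrite /q ltr0_norm // invrN; lra.
have BS : B <= (\sum_i `|f i d|^-1) * eps.
  apply: bigmax_le => // i hi; apply: le_trans (epsE i).
  by rewrite /q gtr0_norm //; lra.
exists (A - B); first by rewrite ler_norml; apply/andP; split; lra.
move=> i; rewrite [y + _]addrC lf.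
have [fi|fi|fi] := ltrgt0P (f i d).
- have : A - B <= q i.
    case: AB => [->|B00]; first by have := hiB i fi; lra.
    rewrite B00 subr0; apply: bigmax_le => [|j hj]; last exact: lohi.
    by have := hiB i fi; rewrite B00; lra.
  by rewrite /q ler_pdivlMr //; lra.
- have : q i <= A - B.
    case: AB => [A00|->]; last by have := loA i fi; lra.
    suff : B <= - q i by rewrite A00; lra.
    apply: bigmax_le => [|j hj]; last by have := lohi j i hj fi; lra.
    by have := loA i fi; rewrite A00; lra.
  by rewrite /q ler_ndivrMr //; lra.
- have := hy (i, i); rewrite /fm_fun /fm_bound /= fi ltxx eqxx /=; lra.
Qed.

End FourierMotzkin.

(** * Hoffman's error bound and Farkas' lemma *)

Section Hoffman.
Variables (R : realFieldType) (V : lmodType R).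

Lemma scalar_sum (g : V -> R) k (c : nat -> R) (e : nat -> V) x : scalar g ->
  g (x + \sum_(l < k) c l *: e l) = g x + \sum_(l < k) c l * g (e l).
Proof.
move=> lg; elim: k => [|k IH]; first by rewrite !big_ord0 !addr0.
by rewrite !big_ord_recr /= addrA [x + _ + _]addrC lg IH; ring.
Qed.

(** Both theorems are proved for moves along finitely many directions e_l, which
    lets the induction eliminate one direction while the space stays the same.
    The move is measured by its coefficients, so no norm enters here. *)
Lemma hoffman_directions (e : nat -> V) k (I : finType)
    (f : I -> V -> R) (b : I -> R) :
  (forall i, scalar (f i)) ->
  exists2 theta, 0 <= theta & forall (x : V) (eps : R), 0 <= eps ->
    (forall i, f i x <= b i + eps) ->
    (exists c : nat -> R,
        forall i, f i (x + \sum_(l < k) c l *: e l) <= b i) ->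
    exists2 c : nat -> R, \sum_(l < k) `|c l| <= theta * eps &
      forall i, f i (x + \sum_(l < k) c l *: e l) <= b i.
Proof.
elim: k I f b => [|k IH] I f b lf.
  exists 0 => // x eps _ _ [c hc]; exists c => //.
  by rewrite big_ord0 mul0r.
have lfm ij : scalar (fm_fun f (e k) ij) by apply: fm_fun_scalar.
have [th' th'0 H] := IH _ _ (fm_bound f b (e k)) lfm.
pose w ij := (fm_weights f (e k) ij).1 + (fm_weights f (e k) ij).2.
have w0 ij : 0 <= w ij by rewrite addr_ge0 //; case: (fm_weights_ge0 f (e k) ij).
(* k1 bounds the residual of the eliminated system, Lip the variation of the
   constraints along the remaining directions, k2 the back substitution. *)
pose k1 := \sum_ij w ij.
pose Lip := \sum_i \sum_(l < k) `|f i (e l)|.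
pose k2 := \sum_i `|f i (e k)|^-1.
have k10 : 0 <= k1 by apply: sumr_ge0.
have k20 : 0 <= k2 by apply: sumr_ge0 => i _; rewrite invr_ge0.
have Lip0 : 0 <= Lip by apply: sumr_ge0 => i _; apply: sumr_ge0.
have fLip i (l : 'I_k) : `|f i (e l)| <= Lip.
  rewrite /Lip (bigD1 i) //= (bigD1 l) //= -addrA lerDl addr_ge0 ?sumr_ge0 //.
  by move=> j _; apply: sumr_ge0.
have wk1 ij : w ij <= k1 by rewrite /k1 (bigD1 ij) //= lerDl sumr_ge0.
exists (th' * k1 + k2 * (1 + Lip * (th' * k1))).
  by rewrite addr_ge0 ?mulr_ge0 ?addr_ge0 ?mulr_ge0.
move=> x eps eps0 hx [c hc].
have relax ij : fm_fun f (e k) ij x <= fm_bound f b (e k) ij + k1 * eps.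
  apply: (@le_trans _ _ (fm_bound f b (e k) ij + w ij * eps)); last first.
    by rewrite lerD2l ler_wpM2r.
  have [w1 w2] := fm_weights_ge0 f (e k) ij.
  have := ler_wpM2l w1 (hx ij.1); have := ler_wpM2l w2 (hx ij.2).
  by rewrite /fm_fun /fm_bound /w; lra.
have feas : exists c : nat -> R, forall ij,
    fm_fun f (e k) ij (x + \sum_(l < k) c l *: e l) <= fm_bound f b (e k) ij.
  exists c => ij; have [w1 w2] := fm_weights_ge0 f (e k) ij.
  have := ler_wpM2l w1 (hc ij.1); have := ler_wpM2l w2 (hc ij.2).
  suff : fm_fun f (e k) ij (x + \sum_(l < k) c l *: e l)
       = fm_fun f (e k) ij (x + \sum_(l < k.+1) c l *: e l).
    by move=> -> h1 h2; apply: (le_trans _ (lerD h2 h1)).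
  by rewrite !scalar_sum // big_ord_recr /= fm_fun_dir mulr0 addr0.
have [c' hc' hy] := H x (k1 * eps) (mulr_ge0 k10 eps0) relax feas.
set y := x + \sum_(l < k) c' l *: e l in hy.
have rely i : f i y <= b i + (eps + Lip * (th' * (k1 * eps))).
  rewrite scalar_sum //.
  suff h : \sum_(l < k) c' l * f i (e l) <= Lip * (th' * (k1 * eps)).
    by have := hx i; lra.
  apply: (@le_trans _ _ (Lip * \sum_(l < k) `|c' l|)); last exact: ler_wpM2l.
  rewrite mulr_sumr ler_sum // => l _; apply: le_trans (ler_norm _) _.
  by rewrite normrM mulrC ler_wpM2r.
have tol0 : 0 <= eps + Lip * (th' * (k1 * eps)).
  by rewrite addr_ge0 ?mulr_ge0.
have [t ht hyt] := fm_eliminate lf tol0 hy rely.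
exists (fun l => if l == k then t else c' l).
- rewrite big_ord_recr /= eqxx.
  under eq_bigr => l _ do rewrite ltn_eqF //.
  apply: (le_trans (lerD hc' ht)); rewrite -/k2; lra.
- move=> i; have := hyt i; rewrite /y -addrA; congr (f i (x + _) <= _).
  rewrite big_ord_recr /= eqxx; congr (_ + _).
  by apply: eq_bigr => l _; rewrite ltn_eqF.
Qed.

(** The certificate is an element of an arbitrary convex cone K of constraints
    containing the given ones. Since elimination only forms nonnegative
    combinations, it stays inside K; multipliers are recovered by choosing K. *)
Lemma farkas_directions (e : nat -> V) k (I : finType)
    (f : I -> V -> R) (b : I -> R) (K : (V -> R) -> R -> Prop) (x : V) :
  (forall i, scalar (f i)) -> (forall i, K (f i) (b i)) ->
  (forall a1 a2 g1 g2 b1 b2, 0 <= a1 -> 0 <= a2 -> K g1 b1 -> K g2 b2 ->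
     K (fun y => a1 * g1 y + a2 * g2 y) (a1 * b1 + a2 * b2)) ->
  (exists c : nat -> R,
     forall i, f i (x + \sum_(l < k) c l *: e l) <= b i) \/
  exists g beta, [/\ K g beta, scalar g, forall l, (l < k)%N -> g (e l) = 0 &
                     beta < g x].
Proof.
elim: k I f b K => [|k IH] I f b K lf hK coneK.
  case: (boolP [forall i, f i x <= b i]) => [/forallP h|].
    by left; exists (fun _ => 0) => i; rewrite big_ord0 addr0.
  rewrite negb_forall => /existsP[i]; rewrite -ltNge => hi.
  by right; exists (f i), (b i); split.
have lfm ij : scalar (fm_fun f (e k) ij) by apply: fm_fun_scalar.
(* The induction hypothesis is used with the smaller cone of constraints that
   vanish along e k, to which all the eliminated constraints belong. *)
have := IH _ _ (fm_bound f b (e k)) (fun g beta => K g beta /\ g (e k) = 0) lfm.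
case.
- move=> ij; split; last exact: fm_fun_dir.
  by have [w1 w2] := fm_weights_ge0 f (e k) ij; exact: coneK.
- move=> a1 a2 g1 g2 b1 b2 a10 a20 [K1 g1e] [K2 g2e]; split; first exact: coneK.
  by rewrite g1e g2e !mulr0 addr0.
- case=> c hc; left; set y := x + _ in hc.
  pose eps := \sum_i `|f i y - b i|.
  have eps0 : 0 <= eps by apply: sumr_ge0.
  have rely i : f i y <= b i + eps.
    rewrite /eps (bigD1 i) //=.
    have := ler_norm (f i y - b i).
    have : 0 <= \sum_(j | j != i) `|f j y - b j| by apply: sumr_ge0.
    lra.
  have [t _ ht] := fm_eliminate lf eps0 hc rely.
  exists (fun l => if l == k then t else c l) => i.
  have := ht i; rewrite /y -addrA; congr (f i (x + _) <= _).
  rewrite big_ord_recr /= eqxx; congr (_ + _).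
  by apply: eq_bigr => l _; rewrite ltn_eqF.
- case=> g [beta [[Kg gk] lg gl hx]]; right; exists g, beta; split=> // l.
  by rewrite ltnS leq_eqVlt => /orP[/eqP ->|/gl].
Qed.

End Hoffman.

Section FiniteDimension.
Variables (R : realFieldType) (V : vectType R).

Let e (l : nat) : V := (vbasis (fullv : {vspace V}))`_l.
Let dim := \dim (fullv : {vspace V}).

Lemma span_basis (v : V) : exists c : nat -> R, v = \sum_(l < dim) c l *: e l.
Proof.
pose c l := if insub l is Some i then coord (vbasis fullv) i v else 0.
exists c; rewrite {1}(coord_vbasis (memvf v)); apply: eq_bigr => l _.
by rewrite /c valK.
Qed.

(** N is a seminorm so that components of y determined by the others can be
    left out of the measured correction. *)
Theorem hoffman (N : V -> R) (I : finType) (f : I -> V -> R) (b : I -> R) :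
  (forall u v, N (u + v) <= N u + N v) ->
  (forall a v, N (a *: v) = `|a| * N v) ->
  (forall i, scalar (f i)) ->
  exists theta, forall (x : V) (eps : R), 0 <= eps ->
    (forall i, f i x <= b i + eps) -> (exists y, forall i, f i y <= b i) ->
    exists2 y, N (y - x) <= theta * eps & forall i, f i y <= b i.
Proof.
move=> ND NZ lf.
have N0 : N 0 = 0 by rewrite -(scale0r 0) NZ normr0 mul0r.
have Nge0 v : 0 <= N v.
  have := ND v (- v); rewrite subrr N0 -scaleN1r NZ normrN1; lra.
have [th th0 H] := hoffman_directions e dim b lf.
exists (th * \sum_(l < dim) N (e l)) => x eps eps0 hx [z hz].
have [|c hc hy] := H x eps eps0 hx.
  have [c hc] := span_basis (z - x); exists c => i.
  by rewrite -hc addrC subrK.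
exists (x + \sum_(l < dim) c l *: e l) => //; rewrite addrC addKr.
apply: (@le_trans _ _ (\sum_(l < dim) `|c l| * N (e l))).
  elim/big_ind2: _ => [|a1 u a2 v h1 h2|l _]; rewrite ?N0 ?NZ //.
  by apply: le_trans (ND _ _) (lerD h1 h2).
apply: (@le_trans _ _ ((\sum_(l < dim) `|c l|) * \sum_(l < dim) N (e l))).
  rewrite mulr_suml ler_sum // => l _; rewrite ler_wpM2l //.
  by rewrite (bigD1 l) //= lerDl sumr_ge0.
by rewrite mulrAC ler_wpM2r // sumr_ge0.
Qed.

Theorem farkas (I : finType) (f : I -> V -> R) (b : I -> R)
    (K : (V -> R) -> R -> Prop) :
  (forall i, scalar (f i)) -> (forall i, K (f i) (b i)) ->
  (forall a1 a2 g1 g2 b1 b2, 0 <= a1 -> 0 <= a2 -> K g1 b1 -> K g2 b2 ->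
     K (fun y => a1 * g1 y + a2 * g2 y) (a1 * b1 + a2 * b2)) ->
  (exists y, forall i, f i y <= b i) \/
  exists g beta, [/\ K g beta, forall y, g y = 0 & beta < 0].
Proof.
move=> lf hK coneK.
have [[c hc]|[g [beta [Kg lg ge hb]]]] := farkas_directions e dim 0 lf hK coneK.
  by left; eexists; exact: hc.
have g0 : g 0 = 0 by have := lg (-1) 0 0; rewrite scaler0 addr0; lra.
right; exists g, beta; split=> //; last by rewrite g0 in hb.
move=> y; have [c ->] := span_basis y.
rewrite -[\sum__ _]add0r scalar_sum // g0 add0r big1 // => l _.
by rewrite ge ?mulr0.
Qed.

End FiniteDimension.

(** * Frobenius inner product and compactness *)

Section Frobenius.
Variable R : realType.

Lemma mxdotE m n (X Y : 'M[R]_(m, n)) : mxdot X Y = \sum_i \sum_j X i j * Y i j.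
Proof.
rewrite /mxdot /mxtrace exchange_big; apply: eq_bigr => j _.
by rewrite mxE; apply: eq_bigr => i _; rewrite mxE.
Qed.

Lemma mxdotC m n (X Y : 'M[R]_(m, n)) : mxdot X Y = mxdot Y X.
Proof.
by rewrite !mxdotE; do 2![apply: eq_bigr => ? _]; rewrite mulrC.
Qed.

Section Space.
Variables m n : nat.
Implicit Types (X Y W : 'M[R]_(m, n)) (a : R).

Lemma mxdotDr X Y W : mxdot X (Y + W) = mxdot X Y + mxdot X W.
Proof. by rewrite -[Y]scale1r mxdot_scalar mul1r scale1r. Qed.

Lemma mxdotZr a X Y : mxdot X (a *: Y) = a * mxdot X Y.
Proof.
by rewrite mxdotE [mxdot X Y]mxdotE mulr_sumr; apply: eq_bigr => i _;
  rewrite mulr_sumr; apply: eq_bigr => j _; rewrite mxE; ring.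
Qed.

Lemma mxdotNr X Y : mxdot X (- Y) = - mxdot X Y.
Proof. by rewrite -scaleN1r mxdotZr mulN1r. Qed.

Lemma mxdotDl X Y W : mxdot (Y + W) X = mxdot Y X + mxdot W X.
Proof. by rewrite mxdotC mxdotDr !(mxdotC X). Qed.

Lemma mxdotZl a X Y : mxdot (a *: Y) X = a * mxdot Y X.
Proof. by rewrite mxdotC mxdotZr mxdotC. Qed.

Lemma mxdotNl X Y : mxdot (- Y) X = - mxdot Y X.
Proof. by rewrite mxdotC mxdotNr mxdotC. Qed.

Lemma mxdot0r X : mxdot X 0 = 0.
Proof. by rewrite -(scale0r 0) mxdotZr mul0r. Qed.

Lemma mxdot0l X : mxdot 0 X = 0.
Proof. by rewrite mxdotC mxdot0r. Qed.

Definition mxdot_lin :=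
  (mxdotDl, mxdotDr, mxdotNl, mxdotNr, mxdotZl, mxdotZr).

Lemma mxdot_ge0 X : 0 <= mxdot X X.
Proof. by rewrite mxdotE !sumr_ge0 // => i _; rewrite sumr_ge0 // => j _; nra. Qed.

Lemma frob_ge0 X : 0 <= frob X. Proof. exact: sqrtr_ge0. Qed.

Lemma sqr_frob X : frob X ^+ 2 = mxdot X X.
Proof. by rewrite sqr_sqrtr ?mxdot_ge0. Qed.

Lemma entry_le_frob X i j : `|X i j| <= frob X.
Proof.
rewrite -sqrtr_sqr ler_wsqrtr // mxdotE (bigD1 i) //= (bigD1 j) //= -addrA expr2.
rewrite lerDl addr_ge0 ?sumr_ge0 // => k _; last rewrite sumr_ge0 // => l _.
  nra.
nra.
Qed.

Lemma mxdot_delta i j X : mxdot (delta_mx i j) X = X i j.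
Proof.
rewrite mxdotE (bigD1 i) //= (bigD1 j) //= !mxE !eqxx mul1r.
rewrite !big1 ?addr0 // => k hk; last first.
  by rewrite mxE eqxx (negPf hk) mul0r.
by rewrite big1 // => l _; rewrite mxE (negPf hk) mul0r.
Qed.

Lemma cauchy_schwarz X Y : `|mxdot X Y| <= frob X * frob Y.
Proof.
have h : 0 <= mxdot Y Y * (mxdot Y Y * mxdot X X - mxdot X Y ^+ 2).
  have := mxdot_ge0 (mxdot Y Y *: X - mxdot X Y *: Y).
  by rewrite !mxdot_lin (mxdotC Y X); nra.
have [Y0|Yp] := eqVneq (frob Y) 0.
  suff -> : Y = 0 by rewrite mxdot0r normr0 mulr_ge0 ?frob_ge0.
  apply/matrixP => i j; rewrite mxE; apply/eqP; rewrite -normr_le0 -Y0.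
  exact: entry_le_frob.
have Yp2 : 0 < mxdot Y Y by rewrite -sqr_frob exprn_gt0 // lt_def Yp frob_ge0.
rewrite -(ler_pXn2r (_ : 0 < 2)%N) ?nnegrE ?mulr_ge0 ?frob_ge0 //.
rewrite real_normK ?num_real // exprMn !sqr_frob.
by have := h; rewrite pmulr_rge0 //; lra.
Qed.

Lemma frobD X Y : frob (X + Y) <= frob X + frob Y.
Proof.
rewrite -(ler_pXn2r (_ : 0 < 2)%N) ?nnegrE ?addr_ge0 ?frob_ge0 //.
rewrite sqr_frob sqrrD !sqr_frob !mxdot_lin (mxdotC Y X).
by have := le_trans (ler_norm _) (cauchy_schwarz X Y); lra.
Qed.

Lemma frobZ a X : frob (a *: X) = `|a| * frob X.
Proof.
by rewrite /frob !mxdot_lin mulrA -expr2 sqrtrM ?sqr_ge0 // sqrtr_sqr.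
Qed.

Lemma frobN X : frob (- X) = frob X.
Proof. by rewrite -scaleN1r frobZ normrN1 mul1r. Qed.

Lemma frob0 : frob (0 : 'M[R]_(m, n)) = 0.
Proof. by rewrite -(scale0r 0) frobZ normr0 mul0r. Qed.

Lemma frobBC X Y : frob (X - Y) = frob (Y - X).
Proof. by rewrite -frobN opprB. Qed.

Lemma frob_le X Y : mxdot X X <= mxdot Y Y -> frob X <= frob Y.
Proof. exact: ler_wsqrtr. Qed.

Lemma frob_eq0 X : frob X = 0 -> X = 0.
Proof.
move=> X0; apply/matrixP => i j; rewrite mxE; apply/eqP.
by rewrite -normr_le0 -X0; exact: entry_le_frob.
Qed.

Lemma frob_triangle X Y W : frob (X - W) <= frob (X - Y) + frob (Y - W).
Proof. by apply: le_trans (frobD _ _); rewrite addrA subrK. Qed.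

Lemma frob_lipschitz Y X W : `|frob (X - Y) - frob (W - Y)| <= frob (X - W).
Proof.
have h1 := frob_triangle X W Y; have h2 := frob_triangle W X Y.
by rewrite (frobBC W X) in h2; rewrite ler_norml; apply/andP; split; lra.
Qed.

Lemma frob_le_entries X : frob X <= \sum_i \sum_j `|X i j|.
Proof.
have delta1 i j : frob (delta_mx i j : 'M[R]_(m, n)) = 1.
  by rewrite /frob mxdot_delta mxE !eqxx sqrtr1.
rewrite [X in frob X]matrix_sum_delta.
elim/big_ind2: _ => [|a1 u a2 v h1 h2|i _]; first by rewrite frob0.
  by apply: le_trans (frobD _ _) (lerD h1 h2).
elim/big_ind2: _ => [|a1 u a2 v h1 h2|j _]; first by rewrite frob0.
  by apply: le_trans (frobD _ _) (lerD h1 h2).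
by rewrite frobZ delta1 mulr1.
Qed.

End Space.

Section Compactness.
Variables m n : nat.
Implicit Types (S : set 'M[R]_(m, n)).

(** Closedness for the Frobenius norm, stated through approximation so that it
    can be checked with Lipschitz estimates. *)
Definition frob_closed S := forall Y,
  (forall eps, 0 < eps -> exists2 W, S W & frob (W - Y) < eps) -> S Y.

Lemma frob_vec_le (v : 'rV[R]_(m * n)) : frob (vec_mx v) <= (m * n)%:R * `|v|.
Proof.
apply: le_trans (frob_le_entries _) _.
have h i j : `|vec_mx v i j| <= `|v|.
  rewrite mxE [leRHS]/Num.norm /= mx_normrE.
  by apply/bigmax_geP; right => /=; exists (ord0, mxvec_index i j).
apply: le_trans (_ : \sum_(i < m) \sum_(j < n) `|v| <= _).
  by apply: ler_sum => i _; apply: ler_sum.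
by rewrite !sumr_const !card_ord mulr_natl mulrnA mulrnAC.
Qed.

(** Flattening matrices to row vectors reduces this to the extreme value
    theorem on a compact set of row vectors. *)
Lemma lipschitz_min S (g : 'M[R]_(m, n) -> R) (L B : R) :
  S !=set0 -> frob_closed S -> (forall X, S X -> frob X <= B) ->
  (forall X Y, `|g X - g Y| <= L * frob (X - Y)) ->
  exists2 X, S X & forall W, S W -> g X <= g W.
Proof.
move=> [X0 SX0] clS bdS lipg.
pose A : set 'rV[R]_(m * n) := [set v | S (vec_mx v)].
have A0 : A !=set0 by exists (mxvec X0); rewrite /A /= mxvecK.
have small (v : 'rV[R]_(m * n)) e : 0 < e ->
    \forall w \near v, frob (vec_mx w - vec_mx v) < e.
  move=> e0; have D0 : 0 < (m * n)%:R + 1 :> R by rewrite ltr_wpDl.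
  apply/nbhs_ballP; exists (e / ((m * n)%:R + 1)) => /=; first exact: divr_gt0.
  move=> w; rewrite mx_norm_ball /ball_ /= => hw.
  rewrite -opprB frobN -linearB; apply: le_lt_trans (frob_vec_le _) _.
  move: hw; rewrite ltr_pdivlMr // => hw; apply: le_lt_trans hw.
  by rewrite mulrC ler_wpM2l // lerDl.
have clA : closed A.
  move=> v hv; apply: clS => e e0.
  by have [w [Aw hw]] := hv _ (small v e e0); exists (vec_mx w).
have bdA : bounded_set A.
  exists B; split; first exact: num_real.
  move=> M BM v Av; rewrite /Num.norm /= mx_normrE.
  have M0 : 0 <= M.
    by apply: le_trans (ltW BM); apply: le_trans (bdS _ Av); exact: frob_ge0.
  apply: bigmax_le => // -[i k] _ /=; rewrite ord1.
  case/mxvec_indexP: k => a b.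
  have := entry_le_frob (vec_mx v) a b; rewrite mxE => h.
  by apply: le_trans h _; apply: le_trans (bdS _ Av) (ltW BM).
have cA := bounded_closed_compact bdA clA.
have cg : {within A, continuous (g \o vec_mx)}.
  apply: continuous_subspaceT => v.
  apply/(@cvgrPdist_lt _ R^o _ (nbhs v) (nbhs_filter v)) => e e0.
  have L0 : 0 < `|L| + 1 by rewrite ltr_wpDl.
  have := small v (e / (`|L| + 1)) (divr_gt0 e0 L0).
  apply: (@filterS _ (nbhs v) (nbhs_filter v)) => w.
  rewrite ltr_pdivlMr // => hw /=.
  rewrite distrC; apply: le_lt_trans (lipg _ _) _; apply: le_lt_trans hw.
  by rewrite mulrC ler_wpM2l ?frob_ge0 //; have := ler_norm L; lra.
have [c] := EVT_min_rV A0 cA cg; rewrite inE => Ac hc.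
exists (vec_mx c) => // W SW; have := hc (mxvec W).
by rewrite /= mxvecK; apply; rewrite inE /A /= mxvecK.
Qed.

End Compactness.
End Frobenius.

(** * Nearest points *)

Section NearestPoint.
Variables (R : realType) (m n : nat).
Implicit Types (S : set 'M[R]_(m, n)) (Y W : 'M[R]_(m, n)).

Lemma projP S Y : S !=set0 -> frob_closed S ->
  S (proj S Y) /\ forall W, S W -> frob (proj S Y - Y) <= frob (W - Y).
Proof.
move=> [W0 SW0] clS; apply: (@xgetPex _ 0 [set Z | S Z /\ _]).
(* S may be unbounded; points farther from Y than W0 cannot be nearest. *)
pose S' := [set W | S W /\ frob (W - Y) <= frob (W0 - Y)].
have S'0 : S' !=set0 by exists W0.
have clS' : frob_closed S'.
  move=> W hW; split.
    by apply: clS => e /hW[W' [SW' _] h]; exists W'.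
  rewrite leNgt; apply/negP => lt0.
  have [|W' [_ h1] h2] := hW (frob (W - Y) - frob (W0 - Y)).
    by rewrite subr_gt0.
  by have := frob_triangle W W' Y; rewrite (frobBC W W'); lra.
have bdS' X : S' X -> frob X <= frob (W0 - Y) + frob Y.
  by case=> _ h; have := frobD (X - Y) Y; rewrite subrK; lra.
have lip X W : `|frob (X - Y) - frob (W - Y)| <= 1 * frob (X - W).
  by rewrite mul1r; exact: frob_lipschitz.
have [X [SX hX] minX] := lipschitz_min S'0 clS' bdS' lip.
exists X; split=> // W SW.
have [h|/ltW h] := leP (frob (W - Y)) (frob (W0 - Y)); first exact: minX.
exact: le_trans h.
Qed.

Lemma dist_le S Y W : frob_closed S -> S W -> dist Y S <= frob (W - Y).
Proof. by move=> clS SW; apply: (projP Y (ex_intro _ W SW) clS).2. Qed.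

End NearestPoint.

(** * Projection onto the matrices with given marginals *)

Section Marginals.
Variables (R : realType) (m n : nat).
Implicit Types (X Y Z V : 'M[R]_(m, n)) (mu : 'cV[R]_m) (nu : 'cV[R]_n).

Definition outer_sum mu nu : 'M[R]_(m, n) :=
  mu *m (ones R n)^T + ones R m *m nu^T.

Lemma outer_sumE mu nu i j : outer_sum mu nu i j = mu i 0 + nu j 0.
Proof. by rewrite !mxE !big_ord1 !mxE mulr1 mul1r. Qed.

Lemma row_sumE X i : (X *m ones R n) i 0 = \sum_j X i j.
Proof. by rewrite mxE; apply: eq_bigr => j _; rewrite !mxE mulr1. Qed.

Lemma col_sumE X j : (X^T *m ones R m) j 0 = \sum_i X i j.
Proof. by rewrite mxE; apply: eq_bigr => i _; rewrite !mxE mulr1. Qed.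

(** Outer sums are the normal directions of the affine space of matrices with
    given marginals: their inner product with X depends on the marginals of X
    only. *)
Lemma mxdot_outer_sum mu nu X :
  mxdot (outer_sum mu nu) X =
  mxdot mu (X *m ones R n) + mxdot nu (X^T *m ones R m).
Proof.
rewrite !mxdotE.
under eq_bigr => i _ do under eq_bigr => j _ do rewrite outer_sumE mulrDl.
under eq_bigr => i _ do rewrite big_split /= -mulr_sumr.
rewrite big_split /= exchange_big /=; congr (_ + _); apply: eq_bigr => k _.
  by rewrite big_ord1 row_sumE.
by rewrite big_ord1 col_sumE mulr_sumr.
Qed.

Lemma row_sum_mxdot X i :
  mxdot (outer_sum (delta_mx i 0) 0) X = (X *m ones R n) i 0.
Proof. by rewrite mxdot_outer_sum mxdot_delta mxdot0l addr0. Qed.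

Lemma col_sum_mxdot X j :
  mxdot (outer_sum 0 (delta_mx j 0)) X = (X^T *m ones R m) j 0.
Proof. by rewrite mxdot_outer_sum mxdot_delta mxdot0l add0r. Qed.

Lemma frob_col_row k l (u : 'cV[R]_k) (v : 'cV[R]_l) :
  frob (u *m v^T) = frob u * frob v.
Proof.
rewrite /frob -sqrtrM ?mxdot_ge0 //; congr Num.sqrt; rewrite !mxdotE.
under [X in _ = X * _]eq_bigr => i _ do rewrite big_ord1.
under [X in _ = _ * X]eq_bigr => i _ do rewrite big_ord1.
rewrite mulr_suml; apply: eq_bigr => i _; rewrite mulr_sumr.
by apply: eq_bigr => j _; rewrite !mxE big_ord1 !mxE; ring.
Qed.

Lemma frob_outer_sum mu nu :
  frob (outer_sum mu nu) <= frob mu * frob (ones R n) + frob (ones R m) * frob nu.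
Proof. by apply: le_trans (frobD _ _) _; rewrite !frob_col_row. Qed.

Lemma outer_sumB mu nu mu' nu' :
  outer_sum mu nu - outer_sum mu' nu' = outer_sum (mu - mu') (nu - nu').
Proof. by apply/matrixP => i j; rewrite !mxE !big_ord1 !mxE; ring. Qed.

Lemma outer_sumZ a mu nu : a *: outer_sum mu nu = outer_sum (a *: mu) (a *: nu).
Proof. by apply/matrixP => i j; rewrite !mxE !big_ord1 !mxE; ring. Qed.

Variables (p : 'cV[R]_m) (q : 'cV[R]_n).

Lemma mxdot_outer_sum_marginals mu nu X :
  marginals p q X -> mxdot (outer_sum mu nu) X = mxdot p mu + mxdot q nu.
Proof.
by case=> Xp Xq; rewrite mxdot_outer_sum Xp Xq mxdotC (mxdotC nu).
Qed.

(** Pythagoras: a displacement Z - V by an outer sum is orthogonal to all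
    differences W - Z of matrices with the same marginals. *)
Lemma proj_marginals_unique mu nu Z V :
  marginals p q Z -> Z - V = outer_sum mu nu -> proj (marginals p q) V = Z.
Proof.
move=> mZ ZV.
have pyth W : marginals p q W ->
    mxdot (W - V) (W - V) = mxdot (W - Z) (W - Z) + mxdot (Z - V) (Z - V).
  move=> mW; have -> : W - V = (W - Z) + (Z - V) by rewrite addrA subrK.
  have orth : mxdot (Z - V) (W - Z) = 0.
    by rewrite ZV mxdotDr mxdotNr !mxdot_outer_sum_marginals // subrr.
  move: (W - Z) (Z - V) orth => D N orth.
  by rewrite !mxdot_lin (mxdotC D N) orth; ring.
have near W : marginals p q W -> frob (Z - V) <= frob (W - V).
  by move=> mW; apply: frob_le; rewrite (pyth W mW) lerDr mxdot_ge0.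
have [mP hP] : [set W | marginals p q W /\
    forall W', marginals p q W' -> frob (W - V) <= frob (W' - V)]
    (proj (marginals p q) V) by apply: xgetPex; exists Z.
apply/eqP; rewrite -subr_eq0; apply/eqP/frob_eq0/eqP.
rewrite -sqrf_eq0 eq_le sqr_ge0 andbT sqr_frob.
have : mxdot (proj (marginals p q) V - V) (proj (marginals p q) V - V)
    <= mxdot (Z - V) (Z - V).
  by rewrite -!sqr_frob ler_pXn2r ?nnegrE ?frob_ge0 //; exact: hP.
by rewrite pyth //; lra.
Qed.

Hypotheses (m_gt0 : (0 < m)%N) (n_gt0 : (0 < n)%N).
Hypotheses (p1 : \sum_i p i 0 = 1) (q1 : \sum_j q j 0 = 1).

Lemma proj_marginals V :
  marginals p q (proj (marginals p q) V) /\
  exists mu nu, proj (marginals p q) V - V = outer_sum mu nu.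
Proof.
have m0 : m%:R != 0 :> R by rewrite pnatr_eq0 -lt0n.
have n0 : n%:R != 0 :> R by rewrite pnatr_eq0 -lt0n.
(* Spreading each marginal defect evenly over its row or column counts the
   total defect 1 - s twice; the last term of nu removes one copy. *)
pose s := \sum_i \sum_j V i j.
have sE : \sum_j \sum_i V i j = s by rewrite exchange_big.
pose mu : 'cV[R]_m := \col_i ((p i 0 - \sum_j V i j) / n%:R).
pose nu : 'cV[R]_n :=
  \col_j ((q j 0 - \sum_i V i j) / m%:R - (1 - s) / (m%:R * n%:R)).
have mZ : marginals p q (V + outer_sum mu nu).
  split; apply/colP => k.
  - rewrite row_sumE; under eq_bigr => j _ do rewrite mxE outer_sumE !mxE.
    rewrite !big_split /= !sumr_const card_ord -mulr_suml sumrB q1.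
    rewrite sE -[X in _ + (X + _)]mulr_natr -[X in _ + (_ + (_ + X))]mulr_natr.
    by field; exact/andP.
  - rewrite col_sumE; under eq_bigr => j _ do rewrite mxE outer_sumE !mxE.
    rewrite !big_split /= !sumr_const card_ord -mulr_suml sumrB p1 -/s.
    rewrite -[X in _ + (_ + (X + _))]mulr_natr -[X in _ + (_ + (_ + X))]mulr_natr.
    by field; exact/andP.
have hZ : (V + outer_sum mu nu) - V = outer_sum mu nu by rewrite addrC addKr.
by rewrite (proj_marginals_unique mZ hZ); split=> //; exists mu, nu.
Qed.

End Marginals.

(** * Entrywise positive part *)

Section PositivePart.
Variables (R : realType) (m n : nat).
Implicit Types A B : 'M[R]_(m, n).

Lemma pospart_ge0 A i j : 0 <= pospart A i j.
Proof. by rewrite mxE le_max lexx orbT. Qed.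

Lemma pospart_ge A i j : A i j <= pospart A i j.
Proof. by rewrite mxE le_max lexx. Qed.

Lemma pospart_complementary A : mxdot (pospart A) (pospart A - A) = 0.
Proof.
rewrite mxdotE big1 // => i _; rewrite big1 // => j _; rewrite !mxE.
by case: (leP (A i j) 0) => h; ring.
Qed.

Lemma pospart_firm A B :
  0 <= mxdot (pospart A - pospart B) ((A - B) - (pospart A - pospart B)).
Proof.
rewrite mxdotE sumr_ge0 // => i _; rewrite sumr_ge0 // => j _; rewrite !mxE.
by case: (leP (A i j) 0) => hA; case: (leP (B i j) 0) => hB; nra.
Qed.

Lemma pospart_nonexpansive A B : frob (pospart A - pospart B) <= frob (A - B).
Proof.
apply: frob_le; have := pospart_firm A B.
move: (pospart A - pospart B) (A - B) => D E.
have := mxdot_ge0 (E - D); rewrite !mxdot_lin (mxdotC E D); lra.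
Qed.

End PositivePart.

(** * Error bound for linear systems *)

Section LinearSystem.
Variables (R : realType).

Definition solves_within (V : lmodType R) (L : linear_system V) (eps : R)
    (x : V) : Prop :=
  all (fun c : {scalar V} * R => `|c.1 x - c.2| <= eps) (equations L) /\
  all (fun c : {scalar V} * R => c.1 x <= c.2 + eps) (inequalities L).

Lemma all_in_tuple (T : Type) (a : pred T) (s : seq T) :
  all a s <-> forall i, a (tnth (in_tuple s) i).
Proof. by split=> /(@all_tnthP _ _ a (in_tuple s)). Qed.

Lemma hoffman_system (V : vectType R) (N : V -> R) (L : linear_system V) :
  (forall u v, N (u + v) <= N u + N v) ->
  (forall a v, N (a *: v) = `|a| * N v) ->
  exists theta, forall (x : V) (eps : R), 0 <= eps -> solves_within L eps x ->
    solutions L !=set0 ->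
    exists2 y, N (y - x) <= theta * eps & solutions L y.
Proof.
move=> ND NZ; set E := in_tuple (equations L); set Q := in_tuple (inequalities L).
pose f (k : ('I_(size (equations L)) * bool + 'I_(size (inequalities L)))%type)
    (x : V) : R :=
  match k with
  | inl (i, true) => (tnth E i).1 x
  | inl (i, false) => - (tnth E i).1 x
  | inr i => (tnth Q i).1 x end.
pose b (k : ('I_(size (equations L)) * bool + 'I_(size (inequalities L)))%type)
    : R :=
  match k with
  | inl (i, true) => (tnth E i).2
  | inl (i, false) => - (tnth E i).2
  | inr i => (tnth Q i).2 end.
have lf k : scalar (f k).
  move=> a u v; case: k => [[i []]|i] /=; rewrite linearP //.
  by rewrite opprD mulrN.
have solP y : solutions L y <-> forall k, f k y <= b k.
  split=> [[/all_in_tuple hE /all_in_tuple hQ] [[i []]|i] /=|h].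
  - by rewrite (eqP (hE i)).
  - by rewrite (eqP (hE i)).
  - exact: hQ.
  - split; apply/all_in_tuple => i; last exact: (h (inr i)).
    have := h (inl (i, true)); have := h (inl (i, false)) => /= h1 h2.
    by rewrite eq_le h2 /= -lerN2.
have [th H] := hoffman b ND NZ lf.
exists th => x eps eps0 [/all_in_tuple hE /all_in_tuple hQ] [z /solP hz].
have [|y hN /solP hy] := H x eps eps0 _ (ex_intro _ z hz); last by exists y.
by move=> [[i []]|i] /=; last exact: hQ; have := hE i; rewrite ler_norml => /andP[];
  lra.
Qed.

End LinearSystem.

Section PrimalDualSystem.
Variables (R : realType) (m n : nat).

(** A seminorm ignoring the component Z: in a solution Z equals X, so a
    correction of Z carries no further information. *)
Definition pd_norm (w : pd_space R m n) : R :=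
  frob (pd_X w) + frob (pd_mu w) + frob (pd_nu w).

Lemma hoffman_constant (L : linear_system (pd_space R m n)) :
  exists theta, 1 <= theta /\
    forall (w : pd_space R m n) (eps : R), 0 <= eps -> solves_within L eps w ->
      solutions L !=set0 ->
      exists2 w', pd_norm (w' - w) <= theta * eps & solutions L w'.
Proof.
pose V : vectType R := ('M[R]_(m, n) * 'M[R]_(m, n) * 'cV[R]_m * 'cV[R]_n)%type.
have [||th H] := @hoffman_system R V pd_norm L.
- move=> u v; rewrite /pd_norm /pd_X /pd_mu /pd_nu /=.
  have := frobD u.1.1.1 v.1.1.1; have := frobD u.1.2 v.1.2.
  have := frobD u.2 v.2; lra.
- by move=> a v; rewrite /pd_norm /pd_X /pd_mu /pd_nu /= !frobZ; ring.
exists (Num.max 1 th); split; first by rewrite le_max lexx.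
move=> w eps eps0 hw hne; have [w' hN hw'] := H w eps eps0 hw hne.
exists w' => //; apply: le_trans hN _.
by rewrite ler_wpM2r // le_max lexx orbT.
Qed.

Lemma pd_solves_within (C X Z : 'M[R]_(m, n)) (p mu : 'cV[R]_m)
    (q nu : 'cV[R]_n) (eps : R) :
  0 <= eps -> marginals p q Z -> (forall i j, 0 <= X i j) ->
  (forall i j, `|Z i j - X i j| <= eps) ->
  (forall i j, outer_sum mu nu i j <= C i j + eps) ->
  `|mxdot C X - mxdot p mu - mxdot q nu| <= eps ->
  solves_within (pd_system C p q) eps (X, Z, mu, nu).
Proof.
move=> eps0 [Zp Zq] X0 ZX hC hgap; rewrite /solves_within /= !all_cat !all_map.
split.
- apply/and4P; split.
  + by apply/allP => i _ /=; rewrite /row_sum /pd_Z /= Zp subrr normr0.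
  + by apply/allP => j _ /=; rewrite /col_sum /pd_Z /= Zq subrr normr0.
  + by apply/all_allpairsP => i j _ _ /=; rewrite subr0; exact: ZX.
  + by rewrite /= subr0 andbT.
- apply/andP; split; apply/all_allpairsP => i j _ _ /=; last exact: hC.
  by rewrite add0r /opp_entry /pd_X /=; have := X0 i j; lra.
Qed.

End PrimalDualSystem.

(** * Existence of primal-dual solutions *)

Section Optimal.
Variables (R : realType) (m n : nat).
Variables (C : 'M[R]_(m, n)) (p : 'cV[R]_m) (q : 'cV[R]_n).

Lemma frob_limit_halfspace (S : set 'M[R]_(m, n)) Y A (b : R) :
  (forall eps, 0 < eps -> exists2 W, S W & frob (W - Y) < eps) ->
  (forall W, S W -> mxdot A W <= b) -> mxdot A Y <= b.
Proof.
move=> hY hS; rewrite leNgt; apply/negP => lt.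
have A0 : 0 < frob A + 1 by rewrite ltr_wpDl ?frob_ge0.
have [|W SW] := hY ((mxdot A Y - b) / (frob A + 1)).
  by rewrite divr_gt0 // subr_gt0.
rewrite ltr_pdivlMr // => hW.
have := le_trans (ler_norm _) (cauchy_schwarz A (Y - W)).
rewrite frobBC mxdotDr mxdotNr; have := hS W SW; have := frob_ge0 (W - Y); lra.
Qed.

Lemma frob_closed_plans : frob_closed (transport_plan p q).
Proof.
move=> Y hY.
have eqP A (b : R) : (forall W, transport_plan p q W -> mxdot A W = b) ->
    mxdot A Y = b.
  move=> h; apply/eqP; rewrite eq_le.
  rewrite (frob_limit_halfspace hY) => [|W /h -> //].
  rewrite -lerN2 -mxdotNl (frob_limit_halfspace hY) // => W /h.
  by rewrite mxdotNl => ->.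
split; first split.
- by apply/colP => i; rewrite -row_sum_mxdot; apply: eqP => W [[<- _] _];
    rewrite row_sum_mxdot.
- by apply/colP => j; rewrite -col_sum_mxdot; apply: eqP => W [[_ <-] _];
    rewrite col_sum_mxdot.
- move=> i j; rewrite -oppr_le0 -mxdot_delta -mxdotNl.
  apply: (frob_limit_halfspace hY) => W [_ W0].
  by rewrite mxdotNl mxdot_delta oppr_le0.
Qed.

Lemma frob_closed_ot_solutions : frob_closed (ot_solutions C p q).
Proof.
move=> Y hY; split.
  by apply: frob_closed_plans => e /hY[W [TW _] hW]; exists W.
by move=> X' TX'; apply: (frob_limit_halfspace hY) => W [_]; apply.
Qed.

Hypotheses (hp : is_prob p) (hq : is_prob q).

Lemma sum_plan X : transport_plan p q X -> \sum_i \sum_j X i j = 1.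
Proof.
case=> -[Xp _] _; rewrite -hp.2; apply: eq_bigr => i _.
by rewrite -row_sumE Xp.
Qed.

Lemma ot_solutions_nonempty : ot_solutions C p q !=set0.
Proof.
have T0 : transport_plan p q !=set0.
  exists (p *m q^T); split; last first.
    by move=> i j; rewrite !mxE big_ord1 !mxE mulr_ge0 ?hp.1 ?hq.1.
  split; apply/colP => k.
    rewrite row_sumE; under eq_bigr => j _ do rewrite mxE big_ord1 mxE.
    by rewrite -mulr_sumr hq.2 mulr1.
  rewrite col_sumE; under eq_bigr => j _ do rewrite mxE big_ord1 mxE.
  by rewrite -mulr_suml hp.2 mul1r.
have bd X : transport_plan p q X -> frob X <= 1.
  move=> TX; rewrite -(sum_plan TX); apply: le_trans (frob_le_entries X) _.
  apply: ler_sum => i _; apply: ler_sum => j _.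
  by rewrite ger0_norm //; exact: TX.2.
have lip X Y : `|mxdot C X - mxdot C Y| <= frob C * frob (X - Y).
  by rewrite -mxdotNr -mxdotDr cauchy_schwarz.
by have [X TX hX] := lipschitz_min T0 frob_closed_plans bd lip; exists X.
Qed.

Definition pd_optimal X mu nu : Prop :=
  [/\ marginals p q X, forall i j, 0 <= X i j,
      forall i j, outer_sum mu nu i j <= C i j &
      mxdot C X - mxdot p mu - mxdot q nu = 0].

Lemma pd_optimalP X mu nu :
  solutions (pd_system C p q) (X, X, mu, nu) <-> pd_optimal X mu nu.
Proof.
have dotE k (a b : 'cV[R]_k) : mxdot a b = (a^T *m b) 0 0.
  by rewrite /mxdot [a^T *m b]mx11_scalar mxtrace_scalar !mxE mulr1n.
rewrite pd_systemP /pd_optimal !dotE.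
by split=> [[h1 h2 _ h3 h4]|[h1 h2 h3 h4]]; split.
Qed.

(** D is a feasible direction at X: it preserves the marginals and does not
    decrease the entries where X vanishes, while the other entries of X are
    bounded away from 0. *)
Lemma shift_plan X D : transport_plan p q X ->
  D *m ones R n = 0 -> D^T *m ones R m = 0 ->
  (forall i j, X i j = 0 -> 0 <= D i j) ->
  exists2 t, 0 < t & transport_plan p q (X + t *: D).
Proof.
move=> [[Xp Xq] X0] De Df hD.
pose delta := \big[Num.min/1]_(ij | X ij.1 ij.2 != 0) X ij.1 ij.2.
have delta0 : 0 < delta.
  apply/bigmin_gtP; split=> // -[i j] /= hij.
  by rewrite lt_def hij X0.
have D1 : 0 < frob D + 1 by rewrite ltr_wpDl ?frob_ge0.
have t0 : 0 < delta / (frob D + 1) by rewrite divr_gt0.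
exists (delta / (frob D + 1)) => //; split.
  split; first by rewrite mulmxDl -scalemxAl De scaler0 addr0.
  by rewrite linearD linearZ /= mulmxDl -scalemxAl Df scaler0 addr0.
move=> i j; rewrite !mxE; have [Xij|Xij] := eqVneq (X i j) 0.
  by rewrite Xij add0r mulr_ge0 ?(ltW t0) ?hD.
have h1 : delta <= X i j.
  exact: (@bigmin_le_cond _ _ _ _ (i, j) _ (fun ij => X ij.1 ij.2)).
have h2 : delta / (frob D + 1) * `|D i j| <= delta.
  rewrite mulrAC ler_pdivrMr // ler_wpM2l ?(ltW delta0) //.
  by have := entry_le_frob D i j; lra.
have := ler_norm (- D i j); rewrite normrN => h3.
have := ler_wpM2l (ltW t0) h3; lra.
Qed.

(** Let X be an optimal plan. Complementary potentials solve the system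
    outer sum <= C everywhere, outer sum >= C on the support of X. If this
    system were infeasible, Farkas' lemma would give multipliers forming a
    matrix D that is nonnegative off the support of X, has zero marginals and
    satisfies <C, D> < 0: a feasible direction along which the cost decreases. *)
Lemma pd_optimal_exists : exists X mu nu, pd_optimal X mu nu.
Proof.
have [X [TX minX]] := ot_solutions_nonempty; have [mX X0] := TX.
pose V : vectType R := ('cV[R]_m * 'cV[R]_n)%type.
(* Index (i, j, true) stands for the upper constraint at (i, j) and
   (i, j, false) for the lower one, replaced by 0 <= 0 off the support of X. *)
pose f (k : 'I_m * 'I_n * bool) (w : V) : R :=
  let u := outer_sum w.1 w.2 k.1.1 k.1.2 in
  if k.2 then u else if X k.1.1 k.1.2 == 0 then 0 else - u.
pose b (k : 'I_m * 'I_n * bool) : R :=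
  let u := C k.1.1 k.1.2 in
  if k.2 then u else if X k.1.1 k.1.2 == 0 then 0 else - u.
pose K (g : V -> R) (beta : R) := exists D : 'M[R]_(m, n),
  [/\ forall i j, X i j = 0 -> 0 <= D i j,
      forall w, g w = mxdot D (outer_sum w.1 w.2) & beta = mxdot D C].
have [|||[w hw]|[g [beta [[D [D0 gD bD]] g0 b0]]]] := @farkas R V _ f b K.
- move=> [[i j] c] a u v; rewrite /f /= !outer_sumE !mxE.
  by case: c => /=; [ring | case: ifP => _; ring].
- move=> [[i j] c]; rewrite /f /b /=; case: c => /=;
    last case: (X i j =P 0) => [Xij|Xij].
  + exists (delta_mx i j); split=> [k l _|w|]; rewrite ?mxdot_delta //.
    by rewrite mxE; exact: ler0n.
  + by exists (0 *: C); split=> [k l _|w|]; rewrite ?mxdotZl ?mxE mul0r.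
  + exists (- delta_mx i j); split=> [k l Xkl|w|];
      rewrite ?mxdotNl ?mxdot_delta //.
    rewrite !mxE; case: andP => [[/eqP ki /eqP lj]|_]; last by rewrite oppr0.
    by case: Xij; rewrite -ki -lj.
- move=> a1 a2 g1 g2 b1 b2 a10 a20 [D1 [D10 gD1 ->]] [D2 [D20 gD2 ->]].
  exists (a1 *: D1 + a2 *: D2); split=> [i j Xij|w|].
  + by rewrite !mxE addr_ge0 // mulr_ge0 ?D10 ?D20.
  + by rewrite gD1 gD2 mxdotDl !mxdotZl.
  + by rewrite mxdotDl !mxdotZl.
- exists X, w.1, w.2; split=> // [i j|]; first exact: (hw ((i, j), true)).
  suff -> : mxdot C X = mxdot (outer_sum w.1 w.2) X.
    by rewrite (mxdot_outer_sum_marginals _ _ mX); ring.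
  rewrite !mxdotE; apply: eq_bigr => i _; apply: eq_bigr => j _.
  have [->|Xij] := eqVneq (X i j) 0; first by rewrite !mulr0.
  congr (_ * _); apply/eqP; rewrite eq_le.
  have /= -> := hw ((i, j), true); rewrite andbT.
  by have := hw ((i, j), false); rewrite /f /b /= (negPf Xij) lerN2.
- exfalso.
  have De : D *m ones R n = 0.
    apply/colP => i; rewrite -row_sum_mxdot mxdotC.
    by rewrite -(gD (delta_mx i 0, 0)) g0 mxE.
  have Df : D^T *m ones R m = 0.
    apply/colP => j; rewrite -col_sum_mxdot mxdotC.
    by rewrite -(gD (0, delta_mx j 0)) g0 mxE.
  have [t t0 TXt] := shift_plan TX De Df D0.
  have := minX _ TXt; rewrite mxdotDr mxdotZr (mxdotC C D) -bD.
  by have := t0; nra.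
Qed.

End Optimal.

(** * The iteration map and its fixed points *)

Section DouglasRachford.
Variables (R : realType) (m n : nat) (hm : (1 <= m)%N) (hn : (1 <= n)%N).
Variables (C : 'M[R]_(m, n)) (p : 'cV[R]_m) (q : 'cV[R]_n) (rho : R).
Hypotheses (hp : is_prob p) (hq : is_prob q) (rho0 : 0 < rho).
Implicit Types (Y : 'M[R]_(m, n)).

Local Notation T := (dr_map C p q rho).
Local Notation G := (dr_fixed C p q rho).
Local Notation shrink Y := (pospart (Y - rho *: C)).

(** With dX, dY, dZ the differences of the shrunken, the current and the
    projected matrices, firmness of the positive part reads
    0 <= <dX, dY - dX>, and orthogonality of the projection reads
    <dZ, 2 dX - dY - dZ> = 0. The claim is a linear combination of the two. *)
Lemma dr_firmly_nonexpansive Y Y' :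
  mxdot (T Y - T Y') (T Y - T Y')
    + mxdot ((T Y - Y) - (T Y' - Y')) ((T Y - Y) - (T Y' - Y'))
  <= mxdot (Y - Y') (Y - Y').
Proof.
have := pospart_firm (Y - rho *: C) (Y' - rho *: C).
rewrite /dr_map; set X := pospart _; set X' := pospart (Y' - _).
have -> : Y - rho *: C - (Y' - rho *: C) = Y - Y' by rewrite opprB addrA subrK.
have [mZ [mu [nu hZ]]] := proj_marginals hm hn hp.2 hq.2 (2 *: X - Y).
have [mZ' [mu' [nu' hZ']]] := proj_marginals hm hn hp.2 hq.2 (2 *: X' - Y').
move: mZ hZ mZ' hZ'; set Z := proj _ _; set Z' := proj _ (2 *: X' - _).
move=> mZ hZ mZ' hZ' firm; clearbody Z Z' X X'.
have orth : mxdot ((Z - (2 *: X - Y)) - (Z' - (2 *: X' - Y'))) (Z - Z') = 0.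
  rewrite hZ hZ' outer_sumB mxdotDr mxdotNr.
  by rewrite !(mxdot_outer_sum_marginals _ _ (p := p) (q := q)) // subrr.
have e1 : Z - (2 *: X - Y) - (Z' - (2 *: X' - Y'))
    = (Z - Z') + (Y - Y') - 2 *: (X - X').
  by apply/matrixP => i j; rewrite !mxE; ring.
have e2 : Y + Z - X - (Y' + Z' - X') = (Y - Y') + (Z - Z') - (X - X').
  by apply/matrixP => i j; rewrite !mxE; ring.
have e3 : Y + Z - X - Y - (Y' + Z' - X' - Y') = (Z - Z') - (X - X').
  by apply/matrixP => i j; rewrite !mxE; ring.
move: firm orth; rewrite e1 e2 e3.
move: (X - X') (Y - Y') (Z - Z') => dX dY dZ.
rewrite !mxdot_lin (mxdotC dX dY) (mxdotC dY dZ) (mxdotC dX dZ); lra.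
Qed.

Lemma dr_nonexpansive Y Y' : frob (T Y - T Y') <= frob (Y - Y').
Proof.
apply: frob_le; apply: le_trans (dr_firmly_nonexpansive Y Y').
by rewrite lerDl mxdot_ge0.
Qed.

Lemma dr_fejer Y W : G W ->
  frob (T Y - W) ^+ 2 + frob (T Y - Y) ^+ 2 <= frob (Y - W) ^+ 2.
Proof.
move=> GW; have := dr_firmly_nonexpansive Y W.
by rewrite !sqr_frob (GW : T W = W) subrr subr0.
Qed.

Lemma frob_closed_dr_fixed : frob_closed G.
Proof.
move=> Y hY; apply/eqP; rewrite -subr_eq0; apply/eqP/frob_eq0/eqP.
rewrite eq_le frob_ge0 andbT leNgt; apply/negP => h.
have [|W GW hW] := hY (frob (T Y - Y) / 2); first by rewrite divr_gt0.
have := frob_triangle (T Y) W Y; have := dr_nonexpansive Y W.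
by rewrite (GW : T W = W) (frobBC Y W); lra.
Qed.

(** The step T Y - Y is the difference of the two half steps, so adding it to
    the shrunken matrix gives the projected one; and the projection displaces
    its argument by an outer sum. *)
Lemma dr_mapE Y : exists mu nu,
  T Y = shrink Y + rho *: outer_sum mu nu /\ marginals p q (shrink Y + (T Y - Y)).
Proof.
rewrite /dr_map; set X := pospart _.
have [mZ [mu [nu hZ]]] := proj_marginals hm hn hp.2 hq.2 (2 *: X - Y).
move: mZ hZ; set Z := proj _ _ => mZ hZ.
exists (rho^-1 *: mu), (rho^-1 *: nu); split; last first.
  by have -> : X + (Y + Z - X - Y) = Z
    by apply/matrixP => i j; rewrite !mxE; ring.
rewrite outer_sumZ !scalerA divff ?gt_eqF // !scale1r -hZ.
by apply/matrixP => i j; rewrite !mxE; ring.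
Qed.

(** At a fixed point, rho C is the sum of an outer sum, which has the same inner
    product with all plans, and of a nonnegative matrix complementary to the
    shrunken one. *)
Lemma dr_fixed_solution Y : G Y -> ot_solutions C p q (shrink Y).
Proof.
move=> GY; have [mu [nu [YE mX]]] := dr_mapE Y.
rewrite (GY : T Y = Y) in YE mX; rewrite subrr addr0 in mX.
have TX : transport_plan p q (shrink Y) by split=> // i j; exact: pospart_ge0.
split=> // X' [mX' X'0].
rewrite -(ler_pM2l rho0) -!mxdotZl.
have UE : rho *: outer_sum mu nu = Y - shrink Y.
  by apply/eqP; rewrite eq_sym subr_eq addrC -YE.
have costE W : mxdot (rho *: C) W =
    mxdot (shrink Y - (Y - rho *: C)) W + mxdot (rho *: outer_sum mu nu) W.
  rewrite -mxdotDl UE; congr (mxdot _ W); move: (shrink Y) => S.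
  by apply/matrixP => i j; rewrite !mxE; ring.
rewrite !costE outer_sumZ.
rewrite !(mxdot_outer_sum_marginals _ _ (p := p) (q := q)) //.
rewrite lerD2r [X in X <= _]mxdotC pospart_complementary mxdotE.
apply: sumr_ge0 => i _; apply: sumr_ge0 => j _; rewrite mulr_ge0 //.
by have := pospart_ge (Y - rho *: C) i j; rewrite !mxE; lra.
Qed.

(** Zero duality gap forces complementary slackness entry by entry, and then
    X - rho (C - U) has positive part X. *)
Lemma pd_optimal_fixed X mu nu :
  pd_optimal C p q X mu nu -> G (X + rho *: outer_sum mu nu).
Proof.
move=> [mX X0 hC gap]; set U := outer_sum mu nu.
have slack0 i j : 0 <= (C i j - U i j) * X i j.
  by rewrite mulr_ge0 // subr_ge0; exact: hC.
have slack : \sum_i \sum_j (C i j - U i j) * X i j = 0.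
  rewrite -[RHS]gap -addrA -opprD -(mxdot_outer_sum_marginals mu nu mX) -mxdotNl.
  rewrite -mxdotDl mxdotE; apply: eq_bigr => i _; apply: eq_bigr => j _.
  by rewrite !mxE.
have compl i j : (C i j - U i j) * X i j = 0.
  have /eqP := slack; rewrite psumr_eq0 => [/allP/(_ i)|k _]; last exact: sumr_ge0.
  rewrite mem_index_enum => /(_ isT)/=; rewrite psumr_eq0 => [/allP/(_ j)|//].
  by rewrite mem_index_enum => /(_ isT)/= /eqP.
have shrinkE : shrink (X + rho *: U) = X.
  move: hC compl; rewrite -/U; clearbody U => hC compl.
  apply/matrixP => i j; rewrite !mxE.
  have cu := hC i j; have x0 := X0 i j; have /eqP := compl i j.
  rewrite -addrA -mulrBr mulf_eq0 subr_eq0 => /orP[/eqP ->|/eqP ->].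
    by rewrite subrr mulr0 addr0 max_l.
  by rewrite max_r // add0r pmulr_rle0 // subr_le0.
rewrite /dr_fixed /= /dr_map shrinkE.
have hproj : X - (2 *: X - (X + rho *: U)) = outer_sum (rho *: mu) (rho *: nu).
  rewrite -outer_sumZ -/U; move: (rho *: U) => W.
  by apply/matrixP => i j; rewrite !mxE; ring.
by rewrite (proj_marginals_unique mX hproj) addrK.
Qed.

Lemma dr_fixed_nonempty : G !=set0.
Proof.
have [X [mu [nu opt]]] := pd_optimal_exists C hp hq.
by exists (X + rho *: outer_sum mu nu); exact: pd_optimal_fixed.
Qed.

(** With D = T Y - Y, complementarity of the positive part turns rho times the
    duality gap into - <D, T Y>, while the excess of the outer sum over C is at
    most D / rho entrywise. *)
Lemma dr_residual Y (mu : 'cV[R]_m) (nu : 'cV[R]_n) :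
  T Y = shrink Y + rho *: outer_sum mu nu ->
  marginals p q (shrink Y + (T Y - Y)) ->
  solves_within (pd_system C p q)
    (frob (T Y - Y) * (1 + rho^-1 * (frob (T Y) + 1)))
    (shrink Y, shrink Y + (T Y - Y), mu, nu).
Proof.
move=> YE mZ; set D := T Y - Y; set eps := _ * _.
have D0 : 0 <= frob D := frob_ge0 _.
have Dr0 : 0 <= frob D * rho^-1 by rewrite mulr_ge0 ?invr_ge0 ?(ltW rho0).
have TD0 : 0 <= frob D * rho^-1 * frob (T Y) by rewrite mulr_ge0 ?frob_ge0.
have epsE : eps = frob D + frob D * rho^-1 * frob (T Y) + frob D * rho^-1.
  by rewrite /eps; ring.
have rhoV x : rho * (x * rho^-1) = x by rewrite mulrCA divff ?mulr1 ?gt_eqF.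
apply: pd_solves_within => //.
- by rewrite epsE !addr_ge0.
- by move=> i j; exact: pospart_ge0.
- move=> i j; rewrite mxE addrAC subrr add0r.
  by apply: le_trans (entry_le_frob _ _ _) _; rewrite epsE; lra.
- move=> i j; suff : outer_sum mu nu i j <= C i j + frob D * rho^-1.
    by rewrite epsE; lra.
  rewrite -(ler_pM2l rho0) mulrDr rhoV.
  have := congr1 (fun A : 'M[R]_(m, n) => A i j) YE.
  have := pospart_ge (Y - rho *: C) i j.
  have := le_trans (ler_norm _) (entry_le_frob D i j).
  rewrite /D; move: (T Y) (shrink Y) (outer_sum mu nu) => TY X U.
  by rewrite !mxE => h1 h2 h3; move: h1; rewrite h3; lra.
- rewrite -addrA -opprD -(mxdot_outer_sum_marginals mu nu mZ).
  suff : `|mxdot C (shrink Y) - mxdot (outer_sum mu nu) (shrink Y + D)|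
      <= frob D * rho^-1 * frob (T Y) by move=> /le_trans; apply; rewrite epsE; lra.
  rewrite -(ler_pM2l rho0) -[X in X * `|_|](gtr0_norm rho0) -normrM.
  rewrite mulrAC rhoV mulrBr -!mxdotZl.
  have -> : rho *: outer_sum mu nu = T Y - shrink Y by rewrite YE addrC addKr.
  have := pospart_complementary (Y - rho *: C).
  have := cauchy_schwarz D (T Y).
  have : T Y = Y + D by rewrite addrC subrK.
  move: (rho *: C) (T Y) (shrink Y) (D) => rC TY X E -> cs.
  rewrite !mxdot_lin => cm; rewrite -normrN; apply: le_trans cs.
  rewrite le_eqVlt; apply/orP; left; apply/eqP; congr (`|_|).
  rewrite !mxdot_lin (mxdotC X Y) (mxdotC X rC) in cm *.
  rewrite (mxdotC E Y) (mxdotC X E); lra.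
Qed.

(** Hoffman's constant times the residual bounds the distance from (X, mu, nu)
    to a solution, and (X, mu, nu) |-> X + rho (mu e^T + f nu^T), which maps the
    current point to T Y and solutions to fixed points, is Lipschitz. *)
Lemma dr_error_bound (theta M : R) Y :
  1 <= theta ->
  (forall (w : pd_space R m n) (eps : R), 0 <= eps ->
     solves_within (pd_system C p q) eps w ->
     solutions (pd_system C p q) !=set0 ->
     exists2 w', pd_norm (w' - w) <= theta * eps &
                 solutions (pd_system C p q) w') ->
  frob (T Y) <= M ->
  dist (T Y) G <= theta * (1 + rho^-1 * (M + 1))
    * (1 + rho * (frob (ones R n) + frob (ones R m))) * frob (T Y - Y).
Proof.
move=> theta1 hoff TM; have [mu [nu [TE mZ]]] := dr_mapE Y.
have res := dr_residual TE mZ.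
set eps := _ * _ in res.
have th0 : 0 <= theta by lra.
have D0 := frob_ge0 (T Y - Y).
have rV0 : 0 <= rho^-1 by rewrite invr_ge0 ltW.
have epsM : eps <= frob (T Y - Y) * (1 + rho^-1 * (M + 1)).
  by rewrite /eps ler_wpM2l // lerD2l ler_wpM2l // lerD2r.
have eps0 : 0 <= eps.
  by rewrite mulr_ge0 // addr_ge0 // mulr_ge0 // addr_ge0 // frob_ge0.
have [|[[[X' Z'] mu'] nu'] hN sol] := hoff _ _ eps0 res.
  have [X [mu1 [nu1 opt]]] := pd_optimal_exists C hp hq.
  by exists (X, X, mu1, nu1); apply/pd_optimalP.
have Z'X' : Z' = X' by have /pd_systemP[] := sol.
rewrite Z'X' in sol hN; have /pd_optimalP/pd_optimal_fixed GW := sol.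
apply: le_trans (dist_le _ frob_closed_dr_fixed GW) _.
have nX := frob_ge0 (X' - shrink Y); have nmu := frob_ge0 (mu' - mu).
have nnu := frob_ge0 (nu' - nu).
have ne := frob_ge0 (ones R n); have nf := frob_ge0 (ones R m).
have split_diff : X' + rho *: outer_sum mu' nu' - T Y
    = (X' - shrink Y) + rho *: outer_sum (mu' - mu) (nu' - nu).
  by rewrite TE -outer_sumB scalerBr opprD addrACA.
have hN' : frob (X' - shrink Y) + frob (mu' - mu) + frob (nu' - nu)
    <= theta * eps by exact: hN.
rewrite split_diff; apply: le_trans (frobD _ _) _; rewrite frobZ gtr0_norm //.
apply: (@le_trans _ _
  (theta * eps * (1 + rho * (frob (ones R n) + frob (ones R m))))).
  have h := ler_wpM2l (ltW rho0) (frob_outer_sum (mu' - mu) (nu' - nu)).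
  have h1 : frob (mu' - mu) * frob (ones R n) <= theta * eps * frob (ones R n).
    by rewrite ler_wpM2r //; lra.
  have h2 : frob (ones R m) * frob (nu' - nu) <= theta * eps * frob (ones R m).
    by rewrite mulrC ler_wpM2r //; lra.
  have h3 := ler_wpM2l (ltW rho0) (lerD h1 h2); lra.
have -> a b c d : a * b * c * d = a * (d * b) * c :> R by ring.
rewrite ler_wpM2r //; last exact: ler_wpM2l.
by rewrite addr_ge0 // mulr_ge0 ?(ltW rho0) // addr_ge0.
Qed.

End DouglasRachford.

(** * Linear convergence *)

Lemma contraction_factor (R : realType) (c d d' g : R) :
  0 < c -> 0 <= d -> 0 <= d' -> d' <= c * g -> d' ^+ 2 + g ^+ 2 <= d ^+ 2 ->
  d' <= d * (c / Num.sqrt (c ^+ 2 + 1)).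
Proof.
move=> c0 d0 d'0 hg hd.
have s0 : 0 < Num.sqrt (c ^+ 2 + 1) by rewrite sqrtr_gt0 ltr_wpDl ?sqr_ge0.
rewrite mulrA ler_pdivlMr // -(ler_pXn2r (_ : 0 < 2)%N) ?nnegrE;
  rewrite ?mulr_ge0 ?(ltW c0) ?(ltW s0) //.
rewrite !exprMn sqr_sqrtr ?addr_ge0 ?sqr_ge0 //.
have hg2 : d' ^+ 2 <= (c * g) ^+ 2.
  by rewrite ler_pXn2r ?nnegrE // (le_trans d'0 hg).
have := ler_wpM2l (sqr_ge0 c) hd; rewrite exprMn in hg2; lra.
Qed.

Theorem theorem2 (R : realType) (m n : nat) (hm : (1 <= m)%N) (hn : (1 <= n)%N) :
  exists theta : linear_system (pd_space R m n) -> R,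
  forall (C : 'M[R]_(m, n)) (p : 'cV[R]_m) (q : 'cV[R]_n),
  (forall i j, 0 <= C i j) -> is_prob p -> is_prob q ->
  0 < theta (pd_system C p q) /\
  forall (rho : R) (X Y Z : nat -> 'M[R]_(m, n)),
  0 < rho ->
  (forall k : nat,
     [/\ X k.+1 = pospart (Y k - rho *: C),
         Z k.+1 = proj (marginals p q) (2 *: X k.+1 - Y k) &
         Y k.+1 = Y k + Z k.+1 - X k.+1]) ->
  (exists M : R, forall k : nat, frob (Y k) <= M) /\
  (forall M : R, (forall k : nat, frob (Y k) <= M) ->
   let gamma := theta (pd_system C p q) * (1 + rho^-1 * (M + 1)) in
   let c := gamma * (1 + rho * (frob (ones R n) + frob (ones R m))) in
   let r := c / Num.sqrt (c ^+ 2 + 1) in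
   [/\ 1 <= c,
       r < 1,
       forall k : nat,
         dist (Y k) (dr_fixed C p q rho)
         <= dist (Y 0%N) (dr_fixed C p q rho) * r ^+ k &
       forall k : nat, (1 <= k)%N ->
         dist (X k) (ot_solutions C p q)
         <= dist (Y 0%N) (dr_fixed C p q rho) * r ^+ k.-1]).
Proof.
have [theta hoff] := choice (@hoffman_constant R m n).
exists theta => C p q _ hp hq; have [theta1 {}hoff] := hoff (pd_system C p q).
split=> [|rho X Y Z rho0 iter]; first exact: lt_le_trans theta1.
have stepY k : Y k.+1 = dr_map C p q rho (Y k).
  by have [XE ZE ->] := iter k; rewrite ZE XE.
have clG := frob_closed_dr_fixed hm hn hp hq (C := C) (rho := rho).
have neG := dr_fixed_nonempty C hp hq rho0.
split.
  have [W GW] := neG; exists (frob (Y 0%N - W) + frob W) => k.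
  have : frob (Y k - W) <= frob (Y 0%N - W).
    elim: k => // k; apply: le_trans; rewrite stepY -[in leLHS](GW : _ = W).
    exact: dr_nonexpansive.
  by have := frobD (Y k - W) W; rewrite subrK; lra.
move=> M hM gamma c r.
have M0 : 0 <= M := le_trans (frob_ge0 _) (hM 0%N).
have gamma1 : 1 <= gamma.
  rewrite mulr_ege1 // lerDl mulr_ge0 ?invr_ge0 ?(ltW rho0) // addr_ge0 //.
have c1 : 1 <= c.
  by rewrite mulr_ege1 // lerDl mulr_ge0 ?(ltW rho0) // addr_ge0 ?frob_ge0.
have c0 : 0 < c := lt_le_trans ltr01 c1.
have s0 : 0 < Num.sqrt (c ^+ 2 + 1) by rewrite sqrtr_gt0 ltr_wpDl ?sqr_ge0.
have r0 : 0 <= r by rewrite divr_ge0 ?(ltW c0) ?(ltW s0).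
have dist0 k : 0 <= dist (Y k) (dr_fixed C p q rho) := frob_ge0 _.
have rate k : dist (Y k) (dr_fixed C p q rho)
    <= dist (Y 0%N) (dr_fixed C p q rho) * r ^+ k.
  elim: k => [|k IH]; first by rewrite expr0 mulr1.
  apply: (@le_trans _ _ (dist (Y k) (dr_fixed C p q rho) * r)); last first.
    by rewrite exprSr mulrA ler_wpM2r.
  have eb : dist (Y k.+1) (dr_fixed C p q rho) <= c * frob (Y k.+1 - Y k).
    by rewrite stepY; apply: dr_error_bound => //; rewrite -stepY.
  apply: contraction_factor eb _ => //.
  have [GP _] := projP (Y k) neG clG.
  have := dr_fejer hm hn hp hq (Y k) GP; rewrite -stepY => fej.
  have -> : dist (Y k) (dr_fixed C p q rho)
      = frob (Y k - proj (dr_fixed C p q rho) (Y k)) by rewrite /dist frobBC.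
  apply: le_trans fej; rewrite lerD2r.
  by rewrite ler_pXn2r ?nnegrE ?frob_ge0 // frobBC; exact: dist_le.
split=> //.
- have : Num.sqrt (c ^+ 2) < Num.sqrt (c ^+ 2 + 1).
    by rewrite ltr_sqrt ?ltrDl // ltr_wpDl ?sqr_ge0.
  by rewrite sqrtr_sqr gtr0_norm // /r ltr_pdivrMr // mul1r.
- case=> // k _; apply: le_trans (rate k).
  have [GP _] := projP (Y k) neG clG.
  have SP := dr_fixed_solution hm hn hp hq rho0 GP.
  apply: le_trans (dist_le _ (@frob_closed_ot_solutions R m n C p q) SP) _.
  have [-> _ _] := iter k; apply: le_trans (pospart_nonexpansive _ _) _.
  by rewrite opprB addrA subrK.
Qed.
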